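(* Let $q=p^k>4$, with $p$ an odd prime, let $n\ge1$, and let $A\subseteq(\mathbb{F}_q^\times)^n$. If $A$ contains no $p$ pairwise distinct elements whose sum is zero in $\mathbb{F}_q^n$ (equivalently, $A$ is distinctly $e_1$-free of length $p$ relative to the torus), then $$|A|\le\sum_{r=3}^p r\,S(p,r)\,M_{q-1}\!\left(n,\left\lfloor\frac{(q-1)n}{r}\right\rfloor\right)\le B_p\,\vartheta_q^n.$$ Consequently, if a sequence over $(\mathbb{F}_q^\times)^n$ contains no zero-sum subsequence of length $p$, then its length is at most $$(p-1)B_p\,\vartheta_q^n.$$ In particular, the exponential base is strictly smaller than the torus alphabet size: $\vartheta_q<q-1$.
   Context: $\mathbb{F}_q^\times=\mathbb{F}_q\setminus\{0\}$, and $(\mathbb{F}_q^\times)^n\subseteq\mathbb{F}_q^n$ is called the torus. A set $A\subseteq X^n$ with $X\subseteq\mathbb{F}_q$ is distinctly $F$-free relative to $X$ (for a polynomial $F$ in $t$ variables) if it contains no coordinatewise zero of $F$ formed by $t$ pairwise distinct elements of $A$; here $X=\mathbb{F}_q^\times$, $t=p$ and $F=e_1=x_1+\cdots+x_p$. A sequence may have repeated values, and a subsequence of length $p$ consists of $p$ terms with distinct indices. For integers $Q\ge2$, $D\ge0$, $M_Q(n,D)=|\{(a_1,\dots,a_n)\in\{0,\dots,Q-1\}^n:a_1+\cdots+a_n\le D\}|$. $S(p,r)$ denotes the Stirling number of the second kind, $B_p=\sum_{r=3}^p r\,S(p,r)$, and $\vartheta_q=\inf_{0<\rho<1}(1+\rho+\cdots+\rho^{q-2})\rho^{-(q-1)/3}$.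 *)

(* Defs.v *)
From mathcomp Require Import all_boot all_order all_algebra.
From mathcomp Require mpoly.
From mathcomp Require Import all_classical all_reals all_analysis.

Set Implicit Arguments.
Unset Strict Implicit.
Unset Printing Implicit Defensive.

Import Order.TTheory GRing.Theory Num.Theory.

Local Open Scope ring_scope.

Definition grid (F : finFieldType) (X : {set F}) (n : nat) :
    {set 'rV[F]_n} :=
  finset (fun v : 'rV[F]_n => [forall j, v ord0 j \in X]).

Definition nonzeros (F : finFieldType) : {set F} :=
  finset (fun x : F => x != 0).

Definition torus (F : finFieldType) (n : nat) : {set 'rV[F]_n} :=
  grid (nonzeros F) n.

Definition distinctly_free (F : finFieldType) (n t : nat) (X : {set F})
    (P : mpoly.mpoly t F) (A : {set 'rV[F]_n}) : Prop :=
  A \subset grid X n /\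
  forall a : 'I_t -> 'rV[F]_n,
    injective a -> (forall i, a i \in A) ->
    ~ (forall j : 'I_n, mpoly.meval (fun i => a i ord0 j) P = 0).

Definition no_distinct_zero_sum (F : finFieldType) (n p : nat)
    (A : {set 'rV[F]_n}) : Prop :=
  forall S : {set 'rV[F]_n},
    S \subset A -> #|S| = p -> \sum_(v in S) v <> 0.

(* As the sum is commutative, choosing p distinct indices of s amounts to
   choosing an (order-preserving) subseq of s of size p. *)
Definition no_zero_sum_subseq (F : finFieldType) (n p : nat)
    (s : seq 'rV[F]_n) : Prop :=
  forall u : seq 'rV[F]_n,
    subseq u s -> size u = p -> \sum_(v <- u) v <> 0.

Definition Mcount (Q n D : nat) : nat :=
  #|finset (fun a : {ffun 'I_n -> 'I_Q} => (\sum_i (a i : nat) <= D)%N)|.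

Definition stirling2 (p r : nat) : nat :=
  #|finset (fun P : {set {set 'I_p}} =>
      finset.partition P [set: 'I_p]%SET && (#|P| == r))|.

Definition Bsum (p : nat) : nat := (\sum_(3 <= r < p.+1) r * stirling2 p r)%N.

Definition theta (R : realType) (q : nat) : R :=
  inf [set (\sum_(0 <= i < q.-1) rho ^+ i) * rho `^ (- (q.-1%:R / 3))
      | rho in [set rho : R | 0 < rho < 1]]%classic.

(* Main.v *)
Require Import Defs.
From mathcomp Require Import all_boot all_order all_algebra.
From mathcomp Require Import all_fingroup all_solvable all_field.
From mathcomp Require mpoly.
From mathcomp Require Import all_classical all_reals all_analysis.
(* The classical layer reuses names of the finite one; these take them back. *)
From mathcomp Require Import fintype finset.

Set Implicit Arguments.
Unset Strict Implicit.
Unset Printing Implicit Defensive.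

Import Order.TTheory GRing.Theory Num.Theory.
Import numFieldNormedType.Exports.

Local Open Scope ring_scope.

(** Let [A] lie in the torus and contain no [p] distinct elements of sum zero.
    For a permutation [s] of the [p] indices, let [[x o s = x]] be the indicator
    that the tuple [x] is constant on the cycles of [s].  Summed over all [s]
    with the sign of [s], these indicators vanish unless [x] is injective
    ([sum_sign_stabilizer]).  Multiply by the indicator of [sum_i x_i = 0].  On
    tuples from [A] injective zero-sum tuples do not exist, so the whole signed
    sum is zero.  The permutations with one or two cycles only see the constant
    tuples: with one cycle this is clear, and with two cycles of lengths [a] and
    [p - a] the equation [a u + (p - a) v = 0] reads [a (u - v) = 0], whence
    [u = v] ([constant_of_two_orbits]).  Hence the part of the sum coming from
    permutations with at least three cycles is supported on the diagonal of
    [A^p].  Its constant diagonal value is the sum of the signs of these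
    permutations, which is [1] modulo [p]: conjugation by a [p]-cycle acts on
    them, preserves signs, and fixes the identity only
    ([sum_sign_three_orbits]).  Grouping permutations by their cycle partition
    gives [signed_partition_identity].

    A diagonal tensor without zeros on the diagonal of [A^p] is not a sum of
    fewer than [#|A|] products of two functions of complementary sets of
    variables ([card_le_partition_rank]).  On the other hand, for a partition
    [P] with [r >= 3] blocks the tensor
    [constant on the blocks, and sum of |B| x_B = 0] is a polynomial of degree
    at most [(q - 1) n] in [r] vectors.  In each of its monomials some block
    carries degree at most [(q - 1) n / r], and exponents can be reduced modulo
    [q - 1] on the torus; collecting monomials by that block and its part of the
    monomial ([low_degree_factorization]) writes the tensor with
    [r * M_(q-1)(n, (q - 1) n / r)] products.  Summing over the [S(p, r)]
    partitions bounds [#|A|].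

    The exponential bound is the usual generating function estimate
    [M(n, D) rho^D <= (1 + ... + rho^(q-2))^n].  At [rho = 1] the function
    defining [theta] equals [q - 1], with logarithmic derivative
    [(q - 2)/2 - (q - 1)/3 = (q - 4)/6 > 0], so its infimum is smaller.  In a
    sequence without zero-sum subsequence of length [p], a term occurs at most
    [p - 1] times and the set of its terms satisfies the hypothesis on [A]. *)

(** * The partition rank of a diagonal tensor *)

(** A space of row vectors of dimension [d] has [d] coordinates on which it
    restricts isomorphically, so it contains a vector equal to [1] on all of
    them.  Here [d >= N - m]. *)
Lemma large_support_kernel (K : fieldType) (N m : nat) (M : 'M[K]_(N, m)) :
  exists2 h : 'rV[K]_N, h *m M = 0 &
    (N - m <= #|[set i | h ord0 i != 0%R]|)%N.
Proof.
set B := row_base (kermx M).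
have fullBT : row_full B^T.
  by rewrite /row_full mxrank_tr -/(row_free B) row_base_free.
set f := fullrankfun fullBT.
set C := rowsub f B^T.
have unitC : C^T \in unitmx by rewrite unitmx_tr; exact: fullrowsub_unit.
set u : 'rV_(\rank (kermx M)) := const_mx 1 *m invmx C^T.
have hf i : (u *m B) ord0 (f i) = 1.
  have <- : (u *m C^T) ord0 i = 1 by rewrite mulmxKV // mxE.
  by rewrite !mxE; apply: eq_bigr => j _; rewrite !mxE.
exists (u *m B).
  apply/sub_kermxP; apply: submx_trans (submxMl u B) _.
  by rewrite eq_row_base.
apply: (@leq_trans (\rank (kermx M))).
  by rewrite mxrank_ker leq_sub2l // rank_leq_col.
rewrite -[X in (X <= _)%N]card_ord -(card_imset predT (@fullrankfun_inj _ _ _ _ fullBT)).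
apply/subset_leq_card/subsetP => _ /imsetP[i _ ->].
by rewrite inE hf oner_neq0.
Qed.

Lemma large_support_annihilator (K : fieldType) (V T : finType)
    (A : {set V}) (P : {set T}) (phi : T -> V -> K) :
  exists2 h : V -> K,
    forall t, t \in P -> \sum_(a in A) h a * phi t a = 0 &
    (#|A| <= #|P| + #|[set a in A | h a != 0%R]|)%N.
Proof.
have [-> | [a0 Aa0]] := set_0Vmem A.
  by exists (fun=> 0) => [t _ | ]; rewrite ?cards0 // big_set0.
pose M : 'M[K]_(#|A|, #|P|) := \matrix_(i, j) phi (enum_val j) (enum_val i).
have [h hM sz] := large_support_kernel M.
exists (fun a => h ord0 (enum_rank_in Aa0 a)) => [t Pt | ].
  rewrite big_enum_val /=.
  move/rowP/(_ (enum_rank_in Pt t)): hM; rewrite !mxE => {2}<-.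
  by apply: eq_bigr => i _; rewrite mxE enum_valK_in enum_rankK_in.
rewrite -leq_subLR (leq_trans sz) // -(card_imset _ enum_val_inj).
apply/subset_leq_card/subsetP => _ /imsetP[i + ->].
by rewrite !inE enum_valK_in enum_valP.
Qed.

Definition update (I : finType) (V : Type) (x : I -> V) (j : I) (a : V) : I -> V :=
  fun i => if i == j then a else x i.

Definition depends_on (I : finType) (V K : Type) (J : {set I})
    (f : (I -> V) -> K) : Prop :=
  forall x y : I -> V, {in J, x =1 y} -> f x = f y.

(** Induction on the number of active coordinates [J].  Pick [j] in [J] and
    orient each product so that [j] belongs to its part [S t].  Contract the
    coordinate [j] against a function [h] annihilating the factors with
    [S t = {j}]: these products disappear, the others remain products of the
    same kind for [J :\ j], and the diagonal becomes [c * h].  Since [h] can be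
    chosen nonzero at all but as many points of [A] as products were lost, the
    induction hypothesis on the support of [h] concludes.  [P] is kept as a
    subset of a fixed type so that it can shrink during the induction. *)
Lemma card_le_partition_rank (K : fieldType) (I V T : finType) (J : {set I})
    (A : {set V}) (c : V -> K) (P : {set T}) (S : T -> {set I})
    (f g : T -> (I -> V) -> K) :
  (0 < #|J|)%N ->
  (forall a, a \in A -> c a != 0) ->
  (forall t, t \in P -> [/\ S t \proper J, S t != set0,
     depends_on (S t) (f t) & depends_on (J :\: S t) (g t)]) ->
  (forall x : I -> V, (forall i, x i \in A) ->
     \sum_(t in P) f t x * g t x =
     \sum_(a in A) c a * [forall i in J, x i == a]%:R) ->
  (#|A| <= #|P|)%N.
Proof.
move E : #|J| => [|k] // _.
elim: k => [|k IHk] in J A c P S f g E * => cN0 splitP fgE.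
  (* a one-element set of coordinates cannot be split *)
  have /cards1P[j Jj] : #|J| == 1%N by rewrite E.
  have P0 : P = set0.
    apply/setP => t; rewrite inE; apply/idP => /splitP[+ + _ _].
    by rewrite Jj properEcard subset1 cards1 => /andP[/orP[]/eqP-> //]; rewrite ?cards1 ?eqxx.
  have [-> | [a Aa]] := set_0Vmem A; first by rewrite cards0.
  have /(_ (fun=> a) (fun=> Aa)) := fgE.
  rewrite P0 big_set0 (bigD1 a) //= big1 ?addr0; last first.
    move=> b /andP[_ ba]; rewrite (_ : [forall _ in _, _] = false) ?mulr0 //.
    by apply/negbTE/forall_inPn; exists j; rewrite ?Jj ?set11 // eq_sym.
  rewrite (_ : [forall _ in _, _] = true) ?mulr1 => [/esym/eqP|].
    by rewrite (negbTE (cN0 _ Aa)).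
  by apply/forall_inP.
have [j Jj] : exists j, j \in J by apply/card_gt0P; rewrite E.
pose S' t := if j \in S t then S t else J :\: S t.
pose f' t := if j \in S t then f t else g t.
pose g' t := if j \in S t then g t else f t.
have splitP' t : t \in P -> [/\ S' t \proper J, j \in S' t,
     depends_on (S' t) (f' t) & depends_on (J :\: S' t) (g' t)].
  move=> /splitP[SJ S0 df dg]; rewrite /S' /f' /g'; case: ifP => jS //.
  split=> //; last 1 first.
  - by rewrite setDDr setDv set0U (setIidPr (proper_sub SJ)).
  - rewrite properEneq subsetDl andbT; apply: contra S0 => /eqP/setP JS.
    apply/eqP/setP => i; rewrite inE; apply/negbTE/negP => iS.
    by have := JS i; rewrite inE iS (subsetP (proper_sub SJ)).
  - by rewrite inE jS.
(* the products in which the coordinate j is separated from all others *)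
pose P1 := [set t in P | S' t == [set j]].
have [h hP1 hA] := large_support_annihilator A P1 (fun t a => f' t (fun=> a)).
pose A' := [set a in A | h a != 0].
rewrite (leq_trans hA) //.
have -> : #|P| = (#|P1| + #|P :\: P1|)%N.
  by rewrite -(cardsID P1 P) (setIidPr _) //; apply/subsetP => t /setIdP[].
rewrite leq_add2l.
apply: (IHk (J :\ j) A' (fun a => c a * h a) (P :\: P1) (fun t => S' t :\ j)
  (fun t x => \sum_(a in A) h a * f' t (update x j a)) g').
- by have := cardsD1 j J; rewrite Jj E => -[].
- by move=> a; rewrite inE => /andP[Aa ha]; rewrite mulf_neq0 ?cN0.
- move=> t; rewrite !inE => /andP[]; case Pt: (t \in P) => //= tP1 _.
  have [SJ jS df dg] := splitP' t Pt; split.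
  + rewrite properEcard setSD ?proper_sub //=.
    have := proper_card SJ; rewrite (cardsD1 j (S' t)) (cardsD1 j J) jS Jj.
    by rewrite ltnS.
  + apply: contra tP1 => /eqP S0; apply/eqP/setP => i; move/setP/(_ i): S0.
    by rewrite !inE; case: eqP => //= ->.
  + move=> x y xy; apply: eq_bigr => a _; congr (_ * _); apply: df => i iS.
    by rewrite /update; case: eqP => // /eqP ij; apply: xy; rewrite !inE ij.
  + move=> x y xy; apply: dg => i; rewrite inE => /andP[iS iJ].
    apply: xy; rewrite !inE negb_and iS orbT /= iJ andbT.
    by apply: contra iS => /eqP->.
- move=> x xA'.
  have xA i : x i \in A by have := xA' i; rewrite inE => /andP[].
  have uA a i : a \in A -> update x j a i \in A.
    by move=> Aa; rewrite /update; case: ifP.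
  have -> : \sum_(t in P :\: P1)
      (\sum_(a in A) h a * f' t (update x j a)) * g' t x =
      \sum_(a in A) h a * \sum_(t in P) f t (update x j a) * g t (update x j a).
    transitivity (\sum_(t in P)
      (\sum_(a in A) h a * f' t (update x j a)) * g' t x).
      rewrite [RHS](big_setID P1) /= [X in _ = X + _]big1 ?add0r // => t.
      rewrite !inE => /andP[_ /andP[Pt /eqP Stj]].
      have [_ _ df _] := splitP' t Pt.
      rewrite (eq_bigr (fun a => h a * f' t (fun=> a))) ?hP1 ?mul0r //.
        by rewrite inE Pt Stj eqxx.
      move=> a _; congr (_ * _); apply: df => i; rewrite Stj inE => /eqP->.
      by rewrite /update eqxx.
    under [RHS]eq_bigr do rewrite mulr_sumr.
    rewrite exchange_big /=; apply: eq_bigr => t Pt.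
    rewrite mulr_suml; apply: eq_bigr => a _; rewrite -mulrA; congr (_ * _).
    have [_ jS df dg] := splitP' t Pt.
    have <- : g' t (update x j a) = g' t x.
      apply: dg => i; rewrite inE /update; case: eqP => // ->.
      by rewrite jS.
    by rewrite /f' /g'; case: ifP => // _; rewrite mulrC.
  have diagE a b : [forall i in J, update x j a i == b] =
      (a == b) && [forall i in J :\ j, x i == b].
    apply/forall_inP/andP => [H | [/eqP <- H] i iJ].
      split; first by have := H j Jj; rewrite /update eqxx.
      apply/forall_inP => i; rewrite !inE => /andP[ij iJ].
      by have := H i iJ; rewrite /update (negbTE ij).
    rewrite /update; case: (i =P j) => // /eqP ij.
    by apply: (forall_inP H); rewrite !inE ij.
  under eq_bigr => a Aa do rewrite (fgE _ (fun i => uA a i Aa)).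
  transitivity (\sum_(a in A) c a * h a * [forall i in J :\ j, x i == a]%:R).
    apply: eq_bigr => a Aa; rewrite (bigD1 a) //= big1 ?addr0 => [|b /andP[_ ba]].
      by rewrite diagE eqxx mulrA (mulrC (h a)).
    by rewrite diagE eq_sym (negbTE ba) mulr0.
  rewrite big_mkcond [RHS]big_mkcond; apply: eq_bigr => a _; rewrite inE.
  by case: (a \in A) => //=; case: eqP => // ->; rewrite mulr0 mul0r.
Qed.

(** * Low-degree polynomial functions on the torus *)

Lemma predn_card_gt0 (F : finFieldType) : (0 < #|F|.-1)%N.
Proof. by rewrite -subn1 subn_gt0 (finNzRing_gt1 F). Qed.

Lemma expf_predn_card (F : finFieldType) (x : F) : x != 0 -> x ^+ #|F|.-1 = 1.
Proof.
move=> x0; apply: (mulIf x0); rewrite -exprSr prednK ?expf_card ?mul1r //.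
exact: ltnW (finNzRing_gt1 F).
Qed.

Lemma rV_eq0_indicator (F : finFieldType) (n : nat) (v : 'rV[F]_n) :
  (v == 0)%:R = \prod_j (1 - v ord0 j ^+ #|F|.-1) :> F.
Proof.
have [-> | /rV0Pn[j vj]] := eqVneq v 0.
  rewrite big1 // => j _; rewrite mxE expr0n.
  by rewrite -[_ == 0%N]negbK -lt0n predn_card_gt0 subr0.
by rewrite (bigD1 j) //= expf_predn_card // subrr mul0r.
Qed.

(** On the torus [x ^+ (q - 1) = 1], so exponents below [q - 1] suffice. *)
Definition exponents (F : finFieldType) (n : nat) : finType :=
  {ffun 'I_n -> 'I_#|F|.-1}.

Definition exponent_degree (F : finFieldType) (n : nat) (m : exponents F n) : nat :=
  (\sum_j (m j : nat))%N.

Definition monomial (F : finFieldType) (n : nat) (m : exponents F n)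
  (v : 'rV[F]_n) : F := \prod_j v ord0 j ^+ m j.

(** The agreement is required on the torus only; this is what allows reduced
    exponents without raising the degree. *)
Definition poly_degree_le (F : finFieldType) (n : nat) (I : finType) (d : nat)
    (f : (I -> 'rV[F]_n) -> F) : Prop :=
  exists c : {ffun I -> exponents F n} -> F,
    forall y : I -> 'rV[F]_n, (forall i, y i \in torus F n) ->
      f y = \sum_(e : {ffun I -> exponents F n} | (\sum_i exponent_degree (e i) <= d)%N)
              c e * \prod_i monomial (e i) (y i).

Section PolyDegree.

Variables (F : finFieldType) (n : nat) (I : finType).
Implicit Types (f g : (I -> 'rV[F]_n) -> F) (d : nat).

Lemma eq_poly_degree_le d f g :
  (forall y, (forall i, y i \in torus F n) -> f y = g y) ->
  poly_degree_le d f -> poly_degree_le d g.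
Proof. by move=> fg [c fE]; exists c => y yT; rewrite -fg // fE. Qed.

Lemma leq_poly_degree_le d d' f :
  (d <= d')%N -> poly_degree_le d f -> poly_degree_le d' f.
Proof.
move=> dd' [c fE].
exists (fun e : {ffun I -> exponents F n} =>
  if (\sum_i exponent_degree (e i) <= d)%N then c e else 0) => y yT.
rewrite fE // big_mkcond [RHS]big_mkcond; apply: eq_bigr => e _.
case: ifP => [led | _]; first by rewrite (leq_trans led dd').
by rewrite mul0r if_same.
Qed.

Lemma poly_degree_leD d f g :
  poly_degree_le d f -> poly_degree_le d g ->
  poly_degree_le d (fun y : I -> 'rV[F]_n => f y + g y).
Proof.
move=> [c fE] [c' gE]; exists (fun e : {ffun I -> exponents F n} => c e + c' e) => y yT.
by rewrite fE // gE // -big_split; apply: eq_bigr => e _; rewrite mulrDl.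
Qed.

Lemma poly_degree_leZ d (a : F) f :
  poly_degree_le d f -> poly_degree_le d (fun y : I -> 'rV[F]_n => a * f y).
Proof.
move=> [c fE]; exists (fun e : {ffun I -> exponents F n} => a * c e) => y yT.
by rewrite fE // mulr_sumr; apply: eq_bigr => e _; rewrite mulrA.
Qed.

Definition reduce_exponent (k : 'I_n -> nat) : exponents F n :=
  [ffun j => Ordinal (ltn_pmod (k j) (predn_card_gt0 F))].

Lemma monomial_reduce (k : 'I_n -> nat) (v : 'rV[F]_n) :
  v \in torus F n -> monomial (reduce_exponent k) v = \prod_j v ord0 j ^+ k j.
Proof.
rewrite inE => /forallP vT; apply: eq_bigr => j _.
rewrite ffunE /= {2}(divn_eq (k j) #|F|.-1) exprD mulnC exprM.
by rewrite expf_predn_card ?expr1n ?mul1r //; have := vT j; rewrite inE.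
Qed.

Lemma poly_degree_le_monomial (k : I -> 'I_n -> nat) :
  poly_degree_le (\sum_i \sum_j k i j)%N
    (fun y : I -> 'rV[F]_n => \prod_i \prod_j y i ord0 j ^+ k i j).
Proof.
pose e0 : {ffun I -> exponents F n} := [ffun i => reduce_exponent (k i)].
exists (fun e : {ffun I -> exponents F n} => (e == e0)%:R) => y yT.
rewrite (bigD1 e0) /=; last first.
  apply: leq_sum => i _; apply: leq_sum => j _; rewrite !ffunE /=.
  exact: leq_mod.
rewrite eqxx mul1r [X in _ + X]big1 ?addr0 => [|e /andP[_ /negbTE->]]; last first.
  by rewrite mul0r.
by apply: eq_bigr => i _; rewrite ffunE monomial_reduce.
Qed.

Lemma poly_degree_le_cst d (a : F) : poly_degree_le d (fun _ : I -> 'rV[F]_n => a).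
Proof.
have := @poly_degree_leZ _ a _ (poly_degree_le_monomial (fun _ _ => 0%N)).
rewrite big1 => [|i _]; last by rewrite big1.
move/(leq_poly_degree_le (leq0n d)); apply: eq_poly_degree_le => y _.
by rewrite big1 ?mulr1 // => i _; rewrite big1.
Qed.

Lemma poly_degree_le_coord (i : I) (j : 'I_n) :
  poly_degree_le 1 (fun y : I -> 'rV[F]_n => y i ord0 j).
Proof.
have := poly_degree_le_monomial (fun i' j' => ((i' == i) && (j' == j)) : nat).
rewrite (bigD1 i) //= (bigD1 j) //= !eqxx big1 => [|j' /negbTE->//].
rewrite big1 ?addn0 => [|i' /negbTE i'i]; last first.
  by rewrite big1 // => j' _; rewrite i'i.
apply: eq_poly_degree_le => y _; rewrite (bigD1 i) //= (bigD1 j) //= !eqxx.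
rewrite big1 => [|j' /negbTE->//]; rewrite big1 ?mulr1 ?expr1 //.
by move=> i' /negbTE i'i; rewrite big1 // => j' _; rewrite i'i.
Qed.

Lemma poly_degree_le_sum (J : Type) (s : seq J) d (f : J -> (I -> 'rV[F]_n) -> F) :
  (forall j, poly_degree_le d (f j)) ->
  poly_degree_le d (fun y : I -> 'rV[F]_n => \sum_(j <- s) f j y).
Proof.
move=> fd; elim: s => [|j s IHs].
  by apply: eq_poly_degree_le (poly_degree_le_cst d 0) => y _; rewrite big_nil.
apply: eq_poly_degree_le (poly_degree_leD (fd j) IHs) => y _.
by rewrite big_cons.
Qed.

Lemma poly_degree_leM d d' f g :
  poly_degree_le d f -> poly_degree_le d' g ->
  poly_degree_le (d + d') (fun y : I -> 'rV[F]_n => f y * g y).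
Proof.
move=> [c fE] [c' gE].
(* h e e' is the product of two monomials, with exponents not yet reduced *)
pose h (e e' : {ffun I -> exponents F n}) (y : I -> 'rV[F]_n) : F :=
  \prod_i \prod_j y i ord0 j ^+ ((e i j : nat) + (e' i j : nat))%N.
pose term (e e' : {ffun I -> exponents F n}) (y : I -> 'rV[F]_n) : F :=
  if (\sum_i exponent_degree (e i) <= d)%N && (\sum_i exponent_degree (e' i) <= d')%N
  then c e * c' e' * h e e' y else 0.
have : poly_degree_le (d + d') (fun y : I -> 'rV[F]_n => \sum_e \sum_e' term e e' y).
  apply: poly_degree_le_sum => e; apply: poly_degree_le_sum => e'.
  rewrite /term; have [/andP[de de'] | _] := boolP (_ && _); last first.
    exact: poly_degree_le_cst.
  apply: poly_degree_leZ.
  have := poly_degree_le_monomial (fun i j => (e i j + e' i j)%N).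
  apply: leq_poly_degree_le; apply: leq_trans (leq_add de de').
  rewrite -big_split; apply: leq_sum => i _; rewrite -big_split.
  exact: leqnn.
apply: eq_poly_degree_le => y yT.
rewrite fE // gE // big_distrlr /= [RHS]big_mkcond; apply: eq_bigr => e _.
rewrite /term; case: ifP => de; last by rewrite big1.
rewrite [RHS]big_mkcond; apply: eq_bigr => e' _; rewrite /=.
case: ifP => // _.
rewrite mulrACA; congr (_ * _); rewrite -big_split /=; apply: eq_bigr => i _.
by rewrite -big_split /=; apply: eq_bigr => j _; rewrite exprD.
Qed.

Lemma poly_degree_le_prod (J : finType) (d : J -> nat) (f : J -> (I -> 'rV[F]_n) -> F) :
  (forall j, poly_degree_le (d j) (f j)) ->
  poly_degree_le (\sum_j d j)%N (fun y : I -> 'rV[F]_n => \prod_j f j y).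
Proof.
move=> fd; elim: (index_enum J) => [|j s IHs].
  rewrite big_nil.
  by apply: eq_poly_degree_le (poly_degree_le_cst _ 1) => y _; rewrite big_nil.
rewrite big_cons.
apply: eq_poly_degree_le (poly_degree_leM (fd j) IHs) => y _.
by rewrite big_cons.
Qed.

Lemma poly_degree_le_exp d f k :
  poly_degree_le d f -> poly_degree_le (k * d) (fun y : I -> 'rV[F]_n => f y ^+ k).
Proof.
move=> fd.
have := @poly_degree_le_prod 'I_k (fun=> d) (fun=> f) (fun=> fd).
rewrite sum_nat_const card_ord; apply: eq_poly_degree_le => y _.
by rewrite prodr_const card_ord.
Qed.

(** The indicator of a linear equation is the product over the coordinates of
    [1 - (sum_i a_i y_ij)^(q-1)], by Fermat's little theorem. *)
Lemma poly_degree_le_zero_sum (a : I -> F) :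
  poly_degree_le (#|F|.-1 * n)
    (fun y : I -> 'rV[F]_n => (\sum_i a i *: y i == 0)%:R).
Proof.
have lin j : poly_degree_le 1 (fun y : I -> 'rV[F]_n => \sum_i a i * y i ord0 j).
  apply: poly_degree_le_sum => i; apply: poly_degree_leZ.
  exact: poly_degree_le_coord.
have factor j : poly_degree_le #|F|.-1 (fun y : I -> 'rV[F]_n =>
    1 + -1 * (\sum_i a i * y i ord0 j) ^+ #|F|.-1).
  apply: poly_degree_leD; first exact: poly_degree_le_cst.
  apply: poly_degree_leZ; rewrite -[X in poly_degree_le X]muln1.
  exact: poly_degree_le_exp.
have := poly_degree_le_prod factor; rewrite sum_nat_const card_ord mulnC.
apply: eq_poly_degree_le => y _; rewrite rV_eq0_indicator.
apply: eq_bigr => j _; rewrite mulN1r summxE.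
by congr (1 - _ ^+ _); apply: eq_bigr => i _; rewrite mxE.
Qed.

End PolyDegree.

(** In a monomial of degree at most [d], the variable [i] of [Y] of least degree
    has degree at most [d / #|Y|]; the monomials are grouped by this [i] and by
    their [i]-part [m].  Variables outside [Y] are frozen at [1], where every
    monomial takes the value [1], so that the cofactors do not depend on them. *)
Lemma low_degree_factorization (F : finFieldType) (n d : nat) (I : finType)
    (Y : {set I}) (f : (I -> 'rV[F]_n) -> F) :
  poly_degree_le d f -> Y != set0 ->
  exists2 G : I -> exponents F n -> (I -> 'rV[F]_n) -> F,
    forall i m, depends_on (Y :\ i) (G i m) &
    forall y, (forall i, y i \in torus F n) ->
      f (fun i => if i \in Y then y i else const_mx 1) =
      \sum_(i in Y) \sum_(m : exponents F n | (exponent_degree m <= d %/ #|Y|)%N)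
         monomial m (y i) * G i m y.
Proof.
move=> [c fE] /set0Pn[i0 Yi0].
pose s (e : {ffun I -> exponents F n}) :=
  [arg min_(i < i0 in Y) exponent_degree (e i)].
have sP e : s e \in Y /\
    forall i, i \in Y -> (exponent_degree (e (s e)) <= exponent_degree (e i))%N.
  by rewrite /s; case: arg_minnP.
pose G i m (y : I -> 'rV[F]_n) := \sum_(e : {ffun I -> exponents F n} |
    [&& (\sum_i exponent_degree (e i) <= d)%N, s e == i & e i == m])
  c e * \prod_(k in Y :\ i) monomial (e k) (y k).
exists G => [i m x y xy | y yT].
  apply: eq_bigr => e _; congr (_ * _); apply: eq_bigr => k kY.
  by rewrite xy.
have y'T i : (if i \in Y then y i else const_mx 1) \in torus F n.
  case: ifP => // _; rewrite inE; apply/forallP => j.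
  by rewrite inE mxE oner_neq0.
rewrite fE // (partition_big s (mem Y)) /= => [|e _]; last by case: (sP e).
apply: eq_bigr => i Yi.
rewrite (partition_big (fun e : {ffun I -> exponents F n} => e i)
  (fun m => exponent_degree m <= d %/ #|Y|)%N) /=; last first.
  move=> e /andP[de /eqP <-]; have [Ys smin] := sP e.
  rewrite leq_divRL; last by apply/card_gt0P; exists i0.
  apply: leq_trans de; rewrite [X in (_ <= X)%N](bigID (mem Y)) /=.
  apply: leq_trans (leq_addr _ _).
  by rewrite mulnC -sum_nat_const; apply: leq_sum.
apply: eq_bigr => m _; rewrite mulr_sumr.
under eq_bigl do rewrite -andbA.
apply: eq_bigr => e /and3P[_ _ /eqP em].
rewrite mulrCA; congr (_ * _).
rewrite (bigID (mem Y)) /= [X in _ * X]big1 ?mulr1; last first.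
  move=> k /negbTE kY; rewrite kY; apply: big1 => j _.
  by rewrite mxE expr1n.
rewrite (bigD1 i) //= Yi em; congr (_ * _).
apply: eq_big => [k | k /andP[-> _] //]; by rewrite !inE andbC.
Qed.

(** * Signed sums over permutations *)

(** Multiplication by the transposition of two indices where [x] agrees is a
    sign-reversing involution of the stabilizer of [x].  Pairing even with odd
    permutations makes this valid in every characteristic. *)
Lemma sum_sign_stabilizer (R : pzRingType) (I : finType) (V : eqType)
    (x : I -> V) :
  ~ injective x ->
  \sum_(s : {perm I} | [forall i, x (s i) == x i]) (-1) ^+ s = 0 :> R.
Proof.
move=> xNinj.
have [i [j ij xij]] : exists i, exists2 j, i != j & x i = x j.
  apply: contrapT => H; apply: xNinj => i j xij; apply/eqP/negPn/negP => ij.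
  by apply: H; exists i, j.
pose t := tperm i j.
have xt k : x (t k) = x k by rewrite /t; case: tpermP => [->|->|].
rewrite (bigID (fun s : {perm I} => odd_perm s)) /= addrC.
rewrite (reindex_inj (mulgI t)) /=.
rewrite [X in X + _](eq_bigl (fun s : {perm I} => [forall k, x (s k) == x k] && s)); last first.
  move=> s; rewrite /t odd_mul_tperm ij /= negbK; congr (_ && _).
  apply/forallP/forallP => H k; last by rewrite permM (eqP (H _)) xt.
  by have := H (t k); rewrite permM /t tpermK -/t xt.
rewrite -big_split big1 //= => s /andP[_ sodd].
by rewrite /t odd_mul_tperm ij sodd /= expr0 expr1 subrr.
Qed.

Lemma porbit_conj (I : finType) (s r : {perm I}) (i : I) :
  porbit (s ^ r)%g (r i) = r @: porbit s i.
Proof.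
apply/setP => j; apply/porbitP/imsetP => [[k ->] | [_ /porbitP[k ->] ->]].
  by exists ((s ^+ k)%g i); rewrite ?mem_porbit // -conjXg permJ.
by exists k; rewrite -conjXg permJ.
Qed.

Lemma card_porbits_conj (I : finType) (s r : {perm I}) :
  #|porbits (s ^ r)%g| = #|porbits s|.
Proof.
rewrite -(card_imset (porbits s) (imset_inj (@perm_inj _ r))).
apply: eq_card => B; apply/imsetP/imsetP => [[i _ ->] | [_ /imsetP[i _ ->] ->]].
  exists (porbit s (r^-1%g i)); first exact: imset_f.
  by rewrite -porbit_conj permKV.
by exists (r i); rewrite ?porbit_conj.
Qed.

Definition rotation (p : nat) : {perm 'I_p} := perm (@ordS_inj p).

Lemma rotationX (p k : nat) (i : 'I_p) :
  ((rotation p ^+ k)%g i : nat) = ((i + k) %% p)%N.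
Proof.
elim: k => [|k IHk]; first by rewrite expg0 perm1 addn0 modn_small.
by rewrite expgSr permM permE /= IHk -addn1 modnDml addn1 addnS.
Qed.

Lemma order_rotation (p : nat) : prime p -> #[rotation p]%g = p.
Proof.
move=> p_pr; apply: nt_prime_order => //.
  apply/permP => i; apply: ord_inj; rewrite rotationX perm1.
  by rewrite modnDr modn_small.
apply/eqP => /permP/(_ (Ordinal (prime_gt0 p_pr)))/(congr1 val).
by rewrite permE perm1 /= modn_small // prime_gt1.
Qed.

(** A permutation commuting with a [p]-cycle is one of its powers, and a
    nontrivial power generates the same transitive group. *)
Lemma rotation_centralizer (p : nat) (s : {perm 'I_p}) :
  prime p -> commute s (rotation p) -> (2 < #|porbits s|)%N -> s = 1%g.
Proof.
move=> p_pr sC; apply: contraTeq => s1.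
pose i0 := Ordinal (prime_gt0 p_pr).
have rot0 (i : 'I_p) : i = (rotation p ^+ i)%g i0.
  by apply: ord_inj; rewrite rotationX add0n modn_small.
have sX : s = (rotation p ^+ s i0)%g.
  apply/permP => i; rewrite [in LHS](rot0 i) -permM -(commuteX i sC) permM.
  by rewrite [in LHS](rot0 (s i0)) -!permM -!expgD addnC expgD permM -rot0.
have sG : <[s]>%g = <[rotation p]>%g.
  apply/eqP; rewrite eqEcard -[#|<[rotation p]>|%g]/(#[rotation p]%g).
  rewrite order_rotation // cycle_subG {1}sX mem_cycle /=.
  rewrite -[#|<[s]>|%g]/(#[s]%g) (nt_prime_order p_pr _ s1) // sX -expgM mulnC expgM.
  by rewrite -[X in (_ ^+ X ^+ _)%g](order_rotation p_pr) expg_order expg1n.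
have sT i : porbit s i = porbit s i0.
  apply/eqP; rewrite eq_porbit_mem porbitE sG -porbitE {1}(rot0 i).
  exact: mem_porbit.
rewrite -leqNgt; apply: leq_trans (_ : 1 <= _)%N => //.
apply: (@leq_trans #|[set porbit s i0]|); last by rewrite cards1.
apply/subset_leq_card/subsetP => _ /imsetP[i _ ->].
by rewrite sT set11.
Qed.

(** Conjugation by the rotation acts on the even and on the odd permutations
    with at least three cycles.  By [rotation_centralizer] the only fixed point
    is the identity, which is even, so the two classes have [1] and [0] elements
    modulo [p]. *)
Lemma sum_sign_three_orbits (R : nzRingType) (p : nat) :
  prime p -> odd p -> p \in [pchar R] ->
  \sum_(s : {perm 'I_p} | (2 < #|porbits s|)%N) (-1) ^+ s = 1 :> R.
Proof.
move=> p_pr p_odd chRp.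
pose S b := [set s : {perm 'I_p} | (2 < #|porbits s|)%N && (odd_perm s == b)].
have natE k k' : k = k' %[mod p] -> k%:R = k'%:R :> R.
  by move=> kk'; rewrite -(GRing.natr_mod_pchar chRp k) kk' (GRing.natr_mod_pchar chRp).
have cardS b : #|S b|%:R = (~~ b)%:R :> R.
  have pG : (p.-group <[rotation p]>)%g by rewrite /pgroup -[#|_|]/(#[_]%g) order_rotation // pnat_id.
  have aS : [acts <[rotation p]>, on S b | @conjg_action _]%g.
    by apply/actsP => r _ s; rewrite !inE /= card_porbits_conj odd_permJ.
  rewrite (natE _ _ (pgroup_fix_mod pG aS)).
  have -> : 'Fix_(S b | @conjg_action _)(<[rotation p]>)%g = if b then set0 else [set 1%g].
    apply/setP => s; rewrite afixJ inE cent_cycle inE.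
    apply/andP/idP => [[/andP[s3 /eqP <-] /cent1P sC] | ].
      by rewrite (rotation_centralizer p_pr sC s3) odd_perm1 set11.
    case: b aS => _; rewrite inE // => /eqP->; rewrite group1 odd_perm1 eqxx andbT.
    split=> //; rewrite card_imset ?card_ord ?odd_prime_gt2 // => i j.
    move=> /setP/(_ i); rewrite porbit_id => /esym/porbitP[k].
    by rewrite expg1n perm1 => ->.
  by case: b {aS}; rewrite ?cards0 ?cards1.
have sumE b : \sum_(s : {perm 'I_p} | (2 < #|porbits s|)%N && (odd_perm s == b))
    (-1) ^+ s = (-1) ^+ b * (~~ b)%:R :> R.
  rewrite (eq_bigr (fun=> (-1) ^+ b)) => [|s /andP[_ /eqP->]//].
  rewrite sumr_const -cardS mulr_natr; congr (_ *+ _).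
  by apply: eq_card => s; rewrite inE.
rewrite (bigID (fun s : {perm 'I_p} => odd_perm s == true)) /= sumE mulr0 add0r.
under eq_bigl do rewrite -(negbK (odd_perm _ == true)) eqb_id -eqbF_neg negbK.
by rewrite sumE expr0 mulr1.
Qed.

(** With values [u] on [a] indices and [v] on the other [p - a], the sum is
    [a (u - v)], and [a] is invertible unless [u] or [v] is not attained. *)
Lemma constant_of_two_orbits (p : nat) (R : nzRingType) (V : lmodType R)
    (x : 'I_p -> V) (s : {perm 'I_p}) :
  prime p -> p \in [pchar R] -> (forall i, x (s i) = x i) ->
  (#|porbits s| <= 2)%N -> \sum_i x i = 0 -> forall i j, x i = x j.
Proof.
move=> p_pr chRp xs s2 x0 i j; apply: contrapT => /eqP xij.
have xsX k m : x ((s ^+ k)%g m) = x m.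
  by elim: k => [|k IHk]; rewrite ?expg0 ?perm1 // expgSr permM xs.
have x_porbit k m : porbit s k = porbit s m -> x k = x m.
  move/eqP; rewrite eq_porbit_mem => /porbitP[e ->]; exact: xsX.
pose u := x i; pose v := x j; pose C := [set k | x k == u].
have xuv k : x k != u -> x k = v.
  move=> /eqP xku; apply: (x_porbit); apply/eqP/negPn/negP => kj.
  suff : (2 < #|[set porbit s i; porbit s j; porbit s k]|)%N.
    rewrite ltnNge (leq_trans _ s2) //; apply/subset_leq_card/subsetP => B.
    by rewrite !inE => /orP[/orP[]|] /eqP->; apply: imset_f.
  have ij : porbit s i != porbit s j.
    by apply: contraNneq xij => /x_porbit ->.
  have ik : porbit s i != porbit s k.
    by apply/eqP => /x_porbit ik; apply: xku; rewrite -ik.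
  by rewrite -setUA cardsU1 !inE negb_or ij ik cards2 eq_sym kj.
have Cp : (0 < #|C| < p)%N.
  apply/andP; split; first by apply/card_gt0P; exists i; rewrite inE eqxx.
  rewrite -[X in (_ < X)%N]card_ord -cardsT; apply: proper_card; apply/properP.
  by split; [exact: subsetT | exists j; rewrite !inE // eq_sym].
have : u *+ #|C| - v *+ #|C| = 0.
  rewrite -[RHS]x0 (bigID (mem C)) /=.
  rewrite (eq_bigr (fun=> u)) => [|k]; last by rewrite inE => /eqP.
  rewrite sumr_const (eq_bigr (fun=> v)) => [|k]; last by rewrite inE => /xuv.
  rewrite sumr_const; congr (_ + _); apply/eqP; rewrite eq_sym -addr_eq0 -mulrnDr.
  rewrite addnC cardC card_ord.
  by rewrite -scaler_nat (pcharf0 chRp) scale0r.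
rewrite -mulrnBl -scaler_nat => uvC.
have cop : coprime #|C| p.
  rewrite coprime_sym prime_coprime //; apply/negP => /dvdn_leq.
  by case/andP: Cp => C0 Cp /(_ C0); rewrite leqNgt Cp.
move: xij; rewrite -subr_eq0 -/u -/v.
case/andP: Cp => C0 _; case: (egcdnP p C0) => a b; rewrite (eqP cop) => E _.
have : (a * #|C|)%:R = (b * p + 1)%:R :> R by rewrite E.
rewrite natrM natrD natrM (pcharf0 chRp) mulr0 add0r => aC.
by rewrite -(scale1r (u - v)) -[1]/(1%:R) -aC -scalerA uvC scaler0 eqxx.
Qed.

(** * The bound for sets without distinct zero sums *)

Definition constant_on (I : finType) (V : eqType) (x : I -> V) (B : {set I}) : bool :=
  [forall i in B, forall j in B, x i == x j].

Lemma constant_onP (I : finType) (V : eqType) (x : I -> V) (B : {set I}) :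
  reflect {in B &, forall i j, x i = x j} (constant_on x B).
Proof.
apply: (iffP forall_inP) => [H i j iB jB | H i iB].
  by have /forall_inP/(_ j jB)/eqP := H i iB.
by apply/forall_inP => j jB; rewrite (H i j).
Qed.

Lemma stabilizer_porbits (I : finType) (V : eqType) (x : I -> V) (s : {perm I}) :
  [forall i, x (s i) == x i] = [forall B in porbits s, constant_on x B].
Proof.
apply/forallP/forall_inP => [H B /imsetP[i0 _ ->] | H i].
  apply/constant_onP.
  have xX k i : x ((s ^+ k)%g i) = x i.
    elim: k => [|k IHk]; first by rewrite expg0 perm1.
    by rewrite expgSr permM (eqP (H _)).
  by move=> i j /porbitP[k ->] /porbitP[l ->]; rewrite !xX.
have /constant_onP := H (porbit s i) (imset_f _ isT).
move=> /(_ (s i) i) ->; rewrite ?porbit_id //.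
by have := mem_porbit s 1 i; rewrite expg1.
Qed.

Lemma partition_porbits (I : finType) (s : {perm I}) :
  finset.partition (porbits s) [set: I].
Proof.
apply/and3P; split.
- apply/eqP/setP => i; rewrite inE; apply/bigcupP.
  by exists (porbit s i); rewrite ?porbit_id ?imset_f.
- apply/finset.trivIsetP => _ _ /imsetP[i _ ->] /imsetP[j _ ->]; apply: contraNT.
  case/pred0Pn => k /andP[/= ki kj].
  by move: ki kj; rewrite -!eq_porbit_mem => /eqP-> /eqP->.
- apply/imsetP => -[i _ /setP/(_ i)]; rewrite inE porbit_id //.
Qed.

Definition rep (I : finType) (i0 : I) (B : {set I}) : I :=
  odflt i0 [pick i in B].

Lemma mem_rep (I : finType) (i0 : I) (B : {set I}) : B != set0 -> rep i0 B \in B.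
Proof.
rewrite /rep; case: pickP => //= B0 /set0Pn[i iB].
by rewrite B0 in iB.
Qed.

Lemma sum_constant_on_blocks (I : finType) (R : nzRingType) (V : lmodType R)
    (i0 : I) (P : {set {set I}}) (x : I -> V) :
  finset.partition P [set: I] -> [forall B in P, constant_on x B] ->
  \sum_i x i = \sum_(B in P) #|B|%:R *: x (rep i0 B).
Proof.
move=> partP /forall_inP xP.
have -> : \sum_i x i = \sum_(i in [set: I]) x i.
  by apply: eq_bigl => i; rewrite inE.
rewrite (finset.set_partition_big _ partP) /=.
apply: eq_bigr => B BP; have B0 : B != set0.
  by apply: contraTneq BP => ->; case/and3P: partP.
rewrite (eq_bigr (fun=> x (rep i0 B))) ?sumr_const ?scaler_nat // => i iB.
by apply: (constant_onP _ _ (xP B BP)); rewrite // mem_rep.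
Qed.

(** The combination of partition tensors with at least three blocks that
    agrees with the diagonal of [A^p]; the coefficient of [P] is the sum of the
    signs of the permutations with cycle partition [P]. *)
Lemma signed_partition_identity (F : finFieldType) (n p : nat)
    (A : {set 'rV[F]_n}) :
  prime p -> odd p -> p \in [pchar F] -> no_distinct_zero_sum p A ->
  forall x : 'I_p -> 'rV[F]_n, (forall i, x i \in A) ->
    \sum_(P : {set {set 'I_p}} | finset.partition P [set: 'I_p] && (2 < #|P|)%N)
      (\sum_(s : {perm 'I_p} | porbits s == P) (-1) ^+ s) *
      ([forall B in P, constant_on x B] && (\sum_i x i == 0))%:R =
    (constant_on x [set: 'I_p])%:R :> F.
Proof.
move=> p_pr p_odd chFp noA x xA.
have [x0 | x0] := eqVneq (\sum_i x i) 0; last first.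
  rewrite big1 => [|P _]; last by rewrite andbF mulr0.
  rewrite (_ : constant_on x _ = false) //; apply: contraNF x0 => /constant_onP xc.
  rewrite (eq_bigr (fun=> x (Ordinal (prime_gt0 p_pr)))) => [|i _]; last first.
    by apply: xc; rewrite inE.
  by rewrite sumr_const card_ord -scaler_nat (pcharf0 chFp) scale0r.
transitivity (\sum_(s : {perm 'I_p} | (2 < #|porbits s|)%N)
    (-1) ^+ s * [forall i, x (s i) == x i]%:R : F).
  rewrite [RHS](partition_big (fun s : {perm 'I_p} => porbits s)
    (fun P => finset.partition P [set: 'I_p] && (2 < #|P|)%N)) /=; last first.
    by move=> s s3; rewrite partition_porbits.
  apply: eq_bigr => P /andP[_ P3]; rewrite andbT mulr_suml.
  apply: eq_big => [s | s /eqP sP]; last by rewrite stabilizer_porbits sP.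
  by case: eqP => [->|]; rewrite ?P3 ?andbF.
have [xc | xNc] := boolP (constant_on x [set: 'I_p]).
  rewrite -[RHS](sum_sign_three_orbits p_pr p_odd chFp).
  apply: eq_bigr => s _; rewrite (_ : [forall i, _] = true) ?mulr1 //.
  by apply/forallP => i; rewrite (constant_onP _ _ xc (s i) i) ?inE.
have xNinj : ~ injective x.
  move=> xinj; apply: (noA [set x i | i : 'I_p]).
  - by apply/subsetP => _ /imsetP[i _ ->].
  - by rewrite card_imset // card_ord.
  - by rewrite big_imset //= => i j _ _; exact: xinj.
have := sum_sign_stabilizer F xNinj; rewrite [X in X = _ -> _]big_mkcond /=.
rewrite (bigID (fun s : {perm 'I_p} => 2 < #|porbits s|)%N) /=.
rewrite [X in _ + X]big1 ?addr0 => [sum0 | s].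
  by rewrite -[RHS]sum0; apply: eq_bigr => s _; case: ifP; rewrite ?mulr1 ?mulr0.
rewrite -leqNgt => s2; case: ifP => // /forallP xs.
case/constant_onP: xNc => i j _ _.
by apply: (constant_of_two_orbits p_pr chFp _ s2 x0) => k; apply/eqP.
Qed.

(** Index set of the products in the decomposition of the diagonal: a
    partition, the block of least degree, and the part of the monomial carried
    by that block. *)
Definition low_degree_terms (F : finFieldType) (n p : nat) :
    {set {set {set 'I_p}} * {set 'I_p} * exponents F n} :=
  [set t | [&& finset.partition t.1.1 [set: 'I_p], (2 < #|t.1.1|)%N, t.1.2 \in t.1.1 &
     (exponent_degree t.2 <= (#|F|.-1 * n) %/ #|t.1.1|)%N]].

Lemma big_low_degree_terms (F : finFieldType) (n p : nat) (R : Type) (idx : R)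
    (op : Monoid.com_law idx) (f : {set {set 'I_p}} -> {set 'I_p} -> exponents F n -> R) :
  \big[op/idx]_(t in low_degree_terms F n p) f t.1.1 t.1.2 t.2 =
  \big[op/idx]_(P : {set {set 'I_p}} | finset.partition P [set: 'I_p] && (2 < #|P|)%N)
    \big[op/idx]_(B in P)
      \big[op/idx]_(m : exponents F n | (exponent_degree m <= (#|F|.-1 * n) %/ #|P|)%N)
         f P B m.
Proof.
rewrite pair_big_dep /= pair_big_dep /=.
by apply: eq_bigl => t; rewrite inE -!andbA.
Qed.

Lemma card_block_partition (I : finType) (P : {set {set I}}) (D : {set I}) :
  finset.partition P D -> (#|P| <= #|D|)%N.
Proof.
move=> partP; rewrite (card_partition partP) -sum1_card.
apply: leq_sum => B BP; rewrite card_gt0.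
by apply: contraTneq BP => ->; case/and3P: partP.
Qed.

Lemma card_low_degree_terms (F : finFieldType) (n p : nat) :
  #|low_degree_terms F n p| = (\sum_(3 <= r < p.+1)
     r * stirling2 p r * Mcount #|F|.-1 n ((#|F|.-1 * n) %/ r))%N.
Proof.
rewrite -sum1_card (@big_low_degree_terms F n p _ _ _ (fun _ _ _ => 1%N)).
rewrite big_geq_mkord.
rewrite (partition_big (fun P : {set {set 'I_p}} => inord #|P| : 'I_p.+1)
   (fun r : 'I_p.+1 => 3 <= r)%N) /=; last first.
  move=> P /andP[partP P3]; rewrite inordK // ltnS.
  by rewrite (leq_trans (card_block_partition partP)) // cardsT card_ord.
apply: eq_bigr => r r3; rewrite mulnAC /stirling2 -sum1_card big_distrr /=.
apply: eq_big => [P | P].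
  rewrite inE; have [partP | //] := boolP (finset.partition P _).
  have leP := card_block_partition partP; rewrite cardsT card_ord in leP.
  rewrite /= -val_eqE /= inordK ?ltnS //; case: eqP => [-> | _]; last by rewrite andbF.
  by rewrite r3.
case/andP=> /andP[partP _] /eqP <-.
have leP := card_block_partition partP; rewrite cardsT card_ord in leP.
rewrite inordK ?ltnS // muln1 sum_nat_const; congr (_ * _)%N.
by rewrite sum1dep_card; apply: eq_card => m; rewrite !inE.
Qed.

(** The identity [signed_partition_identity] decomposes the diagonal of [A^p]
    into [#|low_degree_terms|] products, each separating the indices of one
    block from the others.  The block is a proper subset of the indices because
    its partition has other blocks. *)
Lemma card_no_distinct_zero_sum (F : finFieldType) (n p : nat) (A : {set 'rV[F]_n}) :
  prime p -> odd p -> p \in [pchar F] -> A \subset torus F n ->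
  no_distinct_zero_sum p A ->
  (#|A| <= \sum_(3 <= r < p.+1)
     r * stirling2 p r * Mcount #|F|.-1 n ((#|F|.-1 * n) %/ r))%N.
Proof.
move=> p_pr p_odd chFp AT noA; rewrite -card_low_degree_terms.
pose i0 := Ordinal (prime_gt0 p_pr).
pose w (P : {set {set 'I_p}}) : F := \sum_(s : {perm 'I_p} | porbits s == P) (-1) ^+ s.
(* the cofactors of the low-degree monomials, chosen for all P at once *)
have /choice[G GP] (P : {set {set 'I_p}}) :
  exists G : {set 'I_p} -> exponents F n -> ({set 'I_p} -> 'rV[F]_n) -> F,
    P != set0 ->
    (forall B m, depends_on (P :\ B) (G B m)) /\
    forall y, (forall B, y B \in torus F n) ->
      (\sum_(B in P) #|B|%:R *: y B == 0)%:R =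
      \sum_(B in P) \sum_(m : exponents F n | (exponent_degree m <= (#|F|.-1 * n) %/ #|P|)%N)
         monomial m (y B) * G B m y.
  have [-> | P0] := eqVneq P set0; first by exists (fun _ _ _ => 0).
  have [G dG GE] := low_degree_factorization
    (poly_degree_le_zero_sum n (fun B => if B \in P then #|B|%:R else 0 : F)) P0.
  exists G => _; split=> // y yT; rewrite -GE //; congr (_ == _)%:R.
  rewrite [LHS]big_mkcond; apply: eq_bigr => B _.
  by case: ifP => BP; rewrite ?scale0r.
have part0 P : finset.partition P [set: 'I_p] -> set0 \notin P by case/and3P.
have partD P B C : finset.partition P [set: 'I_p] -> B \in P -> C \in P -> C != B ->
    C \subset ~: B.
  case/and3P=> _ /finset.trivIsetP trivP _ BP CP CB.
  by rewrite -disjoints_subset; apply: trivP.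
have xT (x : 'I_p -> 'rV[F]_n) : (forall i, x i \in A) -> forall i, x i \in torus F n.
  by move=> xA i; apply: (subsetP AT).
pose T := ({set {set 'I_p}} * {set 'I_p} * exponents F n)%type.
apply: (@card_le_partition_rank F 'I_p _ T [set: 'I_p] A (fun=> 1) _
  (fun t => t.1.2)
  (fun t x => w t.1.1 * (constant_on x t.1.2)%:R * monomial t.2 (x (rep i0 t.1.2)))
  (fun t x => \prod_(C in t.1.1 :\ t.1.2) (constant_on x C)%:R *
              G t.1.1 t.1.2 t.2 (fun C => x (rep i0 C)))).
- by rewrite cardsT card_ord prime_gt0.
- by move=> a _; rewrite oner_neq0.
- case=> [[P B] m] /=; rewrite inE /= => /and4P[partP P3 BP _].
  have B0 : B != set0 by apply: contraTneq BP => ->; exact: part0.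
  have P0 : P != set0 by apply/set0Pn; exists B.
  split=> //.
  + rewrite properEneq subsetT andbT; apply: contraTneq P3 => BT.
    have sub1 : P \subset [set B].
      apply/subsetP => C CP; rewrite inE; apply/negPn/negP => CB.
      have := partD P B C partP BP CP CB; rewrite BT setCT subset0 => /eqP C0.
      by move: (part0 P partP); rewrite -C0 CP.
    by rewrite -leqNgt (leq_trans (subset_leq_card sub1)) ?cards1.
  + move=> x y xy; rewrite xy ?mem_rep //; congr (_ * (nat_of_bool _)%:R * _).
    by apply/constant_onP/constant_onP => H i j iB jB; have := H i j iB jB; rewrite !xy.
  + move=> x y xy; have xyC C : C \in P :\ B -> {in C, x =1 y}.
      case/setD1P=> CB CP i iC; apply: xy.
      by have := subsetP (partD P B C partP BP CP CB) i iC; rewrite !inE andbT.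
    congr (_ * _).
      apply: eq_bigr => C /xyC xC; congr (nat_of_bool _)%:R.
      by apply/constant_onP/constant_onP => H i j iB jB; have := H i j iB jB; rewrite !xC.
    have [dG _] := GP P P0; apply: dG => C CPB; rewrite (xyC _ CPB) // mem_rep //.
    by case/setD1P: CPB => _ CP; apply: contraTneq CP => ->; exact: part0.
move=> x xA.
rewrite (@big_low_degree_terms F n p _ _ _ (fun P B m =>
  w P * (constant_on x B)%:R * monomial m (x (rep i0 B)) *
  (\prod_(C in P :\ B) (constant_on x C)%:R * G P B m (fun C => x (rep i0 C))))).
transitivity ((constant_on x [set: 'I_p])%:R : F).
  rewrite -(signed_partition_identity p_pr p_odd chFp noA xA).
  apply: eq_bigr => P /andP[partP P3]; rewrite -/(w P).
  have P0 : P != set0 by rewrite -card_gt0 (leq_trans _ P3).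
  have prodE : \prod_(C in P) (constant_on x C)%:R =
      [forall B in P, constant_on x B]%:R :> F.
    have [/forall_inP xP | ] := boolP [forall B in P, constant_on x B].
      by rewrite big1 // => C /xP ->.
    by case/forall_inPn => C CP /negbTE xC; rewrite (bigD1 C) //= xC mul0r.
  transitivity (w P * ([forall B in P, constant_on x B]%:R *
      (\sum_(B in P) #|B|%:R *: x (rep i0 B) == 0)%:R)); last first.
    have [xP | _] := boolP [forall B in P, constant_on x B]; last by rewrite mul0r.
    by rewrite mul1r -sum_constant_on_blocks.
  have [_ ->] := GP P P0; last by move=> B; exact: xT.
  rewrite -prodE !mulr_sumr; apply: eq_bigr => B BP.
  rewrite !mulr_sumr; apply: eq_bigr => m _.
  rewrite [in RHS](big_setD1 B) //= -!mulrA.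
  by do 2! congr (_ * _); rewrite mulrCA.
have [xc | xNc] := boolP (constant_on x [set: 'I_p]).
  rewrite (bigD1 (x i0)) //= [X in _ + X]big1 => [|a /andP[_ ax]].
    rewrite mul1r addr0 (_ : [forall _ in _, _] = true) //.
    by apply/forall_inP => i _; rewrite (constant_onP _ _ xc i i0) ?inE.
  rewrite mul1r (_ : [forall _ in _, _] = false) //.
  by apply/negbTE/forall_inPn; exists i0; rewrite ?inE // eq_sym.
rewrite big1 // => a _; rewrite mul1r (_ : [forall _ in _, _] = false) //.
apply: contraNF xNc => /forall_inP xa; apply/constant_onP => i j _ _.
by rewrite (eqP (xa i _)) ?(eqP (xa j _)) ?inE.
Qed.

(** * Distinctness, sequences, and the exponential base *)

Lemma no_distinct_zero_sumP (F : finFieldType) (n p : nat) (A : {set 'rV[F]_n}) :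
  A \subset torus F n ->
  (no_distinct_zero_sum p A <->
   distinctly_free (nonzeros F) (mpoly.mesym p F 1) A).
Proof.
move=> AT.
have evalE (a : 'I_p -> 'rV[F]_n) (j : 'I_n) :
    mpoly.meval (fun i => a i ord0 j) (mpoly.mesym p F 1) = (\sum_i a i) ord0 j.
  rewrite mpoly.mesym1E summxE (big_morph _ (mpoly.mevalD _) (mpoly.meval0 _)).
  by apply: eq_bigr => i _; exact: mpoly.mevalXU.
split=> [noA | [_ freeA] S SA cardS S0].
  split=> // a ainj aA a0; apply: (noA [set a i | i : 'I_p]).
  - by apply/subsetP => _ /imsetP[i _ ->].
  - by rewrite card_imset // card_ord.
  - rewrite big_imset /=; last by move=> i j _ _; exact: ainj.
    by apply/rowP => j; rewrite -[LHS]/((\sum_i a i) ord0 j) -evalE a0 mxE.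
pose a (i : 'I_p) : 'rV[F]_n := enum_val (cast_ord (esym cardS) i).
apply: (freeA a) => [i j /enum_val_inj/cast_ord_inj // | i | j].
  exact: (subsetP SA) (enum_valP _).
rewrite evalE; suff -> : \sum_i a i = 0 by rewrite mxE.
rewrite -[RHS]S0 [RHS]big_enum_val /= (reindex (cast_ord cardS)) /=.
  by apply: eq_bigr => i _; rewrite /a cast_ordK.
by exists (cast_ord (esym cardS)) => i _; rewrite ?cast_ordK ?cast_ordKV.
Qed.

Lemma size_le_card_mem (T : finType) (c : nat) (s : seq T) :
  (forall x, (count_mem x s <= c)%N) -> (size s <= c * #|[set x in s]|)%N.
Proof.
move=> sc; rewrite -sum1_size big_seq.
rewrite (partition_big id (mem [set x in s])) /= => [|x xs]; last by rewrite inE.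
rewrite mulnC -sum_nat_const; apply: leq_sum => x _.
apply: leq_trans (sc x); rewrite -sum1_count.
by rewrite [X in (_ <= X)%N](bigID (mem s)) /= (eq_bigl _ _ (fun i => andbC _ _)) leq_addr.
Qed.

(** [p] copies of an element have sum zero in characteristic [p]. *)
Lemma no_zero_sum_subseq_count (F : finFieldType) (n p : nat) (s : seq 'rV[F]_n) :
  p \in [pchar F] -> no_zero_sum_subseq p s ->
  forall x, (count_mem x s <= p.-1)%N.
Proof.
move=> chFp nos x; have p0 := prime_gt0 (pcharf_prime chFp).
rewrite -ltnS prednK // ltnNge; apply/negP => px.
have sizef : size (seq.filter (pred1 x) s) = count_mem x s by rewrite size_filter.
have /all_pred1P fE := filter_all (pred1 x) s.
apply: (nos (nseq p x)); rewrite ?size_nseq //.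
  apply: subseq_trans (filter_subseq (pred1 x) s).
  by rewrite fE sizef -(subnKC px) nseqD prefix_subseq.
by rewrite big_nseq iter_addr_0 -scaler_nat (pcharf0 chFp) scale0r.
Qed.

(** A subset of the support is listed, in an order that makes it a subsequence,
    by filtering the duplicate-free subsequence of [s]. *)
Lemma no_zero_sum_subseq_support (F : finFieldType) (n p : nat) (s : seq 'rV[F]_n) :
  no_zero_sum_subseq p s -> no_distinct_zero_sum p [set x in s].
Proof.
move=> nos S /subsetP Ss cardS.
have memE : [seq x <- undup s | x \in S] =i enum S.
  move=> x; rewrite mem_filter mem_undup mem_enum; case xS: (x \in S) => //=.
  by have := Ss x xS; rewrite inE.
have permE : perm_eq [seq x <- undup s | x \in S] (enum S).
  by apply: (uniq_perm _ (enum_uniq _) memE); exact: filter_uniq (undup_uniq _).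
rewrite -big_enum /= -(perm_big _ permE) /=; apply: nos.
  exact: subseq_trans (filter_subseq _ _) (undup_subseq _).
by rewrite (perm_size permE) -cardE.
Qed.

Definition theta_fun (R : realType) (Q : nat) (rho : R) : R :=
  (\sum_(0 <= i < Q) rho ^+ i) * rho `^ (- (Q%:R / 3)).

Lemma theta_fun_ge0 (R : realType) (Q : nat) (rho : R) :
  0 < rho -> 0 <= theta_fun Q rho.
Proof.
move=> rho0; rewrite mulr_ge0 ?powR_ge0 // sumr_ge0 // => i _.
by rewrite exprn_ge0 // ltW.
Qed.

Lemma theta_le (R : realType) (q : nat) (rho : R) :
  0 < rho < 1 -> theta R q <= theta_fun q.-1 rho.
Proof.
move=> rho01; apply: ge_inf; last by exists rho.
by exists 0 => _ [s /andP[s0 _] <-]; exact: theta_fun_ge0.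
Qed.

Lemma le_theta (R : realType) (q : nat) (y : R) :
  (forall rho : R, 0 < rho < 1 -> y <= theta_fun q.-1 rho) -> y <= theta R q.
Proof.
move=> yle; apply: lb_le_inf; last by move=> _ [rho rho01 <-]; exact: yle.
exists (theta_fun q.-1 2^-1), 2^-1 => //=.
by rewrite invr_gt0 ltr0n /= invf_lt1 ?ltr1n ?ltr0n.
Qed.

(** Keep, in the expansion of the power, the monomials of exponent at most
    [D]; each of them is at least [rho ^+ D] because [rho <= 1]. *)
Lemma Mcount_generating_bound (R : realFieldType) (Q n D : nat) (rho : R) :
  0 < rho <= 1 ->
  (Mcount Q n D)%:R * rho ^+ D <= (\sum_(0 <= i < Q) rho ^+ i) ^+ n.
Proof.
move=> /andP[rho0 rho1].
have -> : (\sum_(0 <= i < Q) rho ^+ i) ^+ n =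
    \sum_(a : {ffun 'I_n -> 'I_Q}) rho ^+ (\sum_j (a j : nat))%N.
  rewrite big_mkord -{1}(card_ord n) -prodr_const.
  rewrite (bigA_distr_bigA (fun (_ : 'I_n) (i : 'I_Q) => rho ^+ i)).
  by apply: eq_bigr => a _; rewrite expr_sum.
rewrite mulr_natl /Mcount -sumr_const.
rewrite [leRHS](bigID (mem (finset (fun a : {ffun 'I_n -> 'I_Q} =>
  (\sum_i (a i : nat) <= D)%N)))) /=.
rewrite -[leLHS]addr0 lerD //; last first.
  by apply: sumr_ge0 => a _; rewrite exprn_ge0 // ltW.
apply: ler_sum => a; rewrite inE => aD.
by rewrite ler_wiXn2l // ltW.
Qed.

(** The generating function bounds [Mcount] by the [n]-th power of each value
    whose infimum is [theta]; taking [n]-th roots first lets the bound pass to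
    the infimum. *)
Lemma Mcount_le_theta (R : realType) (q n D : nat) :
  (0 < n)%N -> (3 * D <= q.-1 * n)%N ->
  (Mcount q.-1 n D)%:R <= theta R q ^+ n.
Proof.
move=> n0 D3; set M : R := (Mcount _ _ _)%:R.
have M0 : 0 <= M by rewrite ler0n.
have yn : (M `^ n%:R^-1) ^+ n = M.
  by rewrite -powR_mulrn ?powR_ge0 // -powRrM mulVf ?powRr1 // pnatr_eq0 -lt0n.
rewrite -yn lerXn2r ?nnegrE ?powR_ge0 //.
  by apply: le_theta => rho /andP[rho0 _]; exact: theta_fun_ge0.
apply: le_theta => rho /andP[rho0 rho1].
rewrite -(@ler_pXn2r _ n) ?nnegrE ?powR_ge0 ?theta_fun_ge0 // yn.
rewrite /theta_fun exprMn powRN exprVn -[(rho `^ _) ^+ n]powR_mulrn ?powR_ge0 // -powRrM.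
rewrite ler_pdivlMr ?powR_gt0 //.
apply: le_trans (Mcount_generating_bound q.-1 n D _); last by rewrite rho0 ltW.
rewrite ler_wpM2l // -(powR_mulrn D (ltW rho0)) ger_powR ?rho0 ?(ltW rho1) //.
by rewrite mulrAC ler_pdivlMr ?ltr0n // mulrC -!natrM ler_nat.
Qed.

(** With [rho = s^3] and [Q = q - 1] the claim is [P(s) > 0] for some [s] in
    [(0, 1)], where [P = Q X^Q - sum_(i < Q) X^(3 i)].  Since [P(1) = 0] and
    [P'(1) = Q (3 - Q) / 2 < 0], the quotient [T] of [P] by [X - 1] is negative
    near [1]. *)
Lemma theta_lt (R : realType) (q : nat) : (4 < q)%N -> theta R q < q.-1%:R.
Proof.
case: q => // Q; rewrite ltnS /= => Q4.
pose P : {poly R} := Q%:R *: 'X^Q - \sum_(i < Q) 'X^(3 * i).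
have hornerP s : P.[s] = Q%:R * s ^+ Q - \sum_(i < Q) s ^+ (3 * i).
  rewrite hornerD hornerN hornerZ hornerXn horner_sum; congr (_ - _).
  by apply: eq_bigr => i _; rewrite hornerXn.
have /factor_theorem[T PT] : root P 1.
  rewrite rootE hornerP expr1n mulr1 (eq_bigr (fun=> 1)) => [|i _]; last first.
    by rewrite expr1n.
  by rewrite sumr_const card_ord subrr.
have T1 : T.[1] < 0.
  have -> : T.[1] = P^`().[1].
    rewrite PT derivM derivXsubC mulr1 hornerD hornerM hornerXsubC subrr mulr0.
    by rewrite add0r.
  rewrite derivB derivZ derivXn hornerD hornerN hornerZ hornerMn hornerXn expr1n.
  rewrite raddf_sum /= horner_sum (eq_bigr (fun i : 'I_Q => (3 * i)%:R)); last first.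
    by move=> i _; rewrite /= derivXn hornerMn hornerXn expr1n.
  rewrite -natr_sum -big_distrr /= -(big_mkord predT id) /= bin2_sum.
  rewrite -natrM subr_lt0 ltr_nat -(ltn_pmul2l (isT : (0 < 2)%N)) mulnCA.
  rewrite (mulnCA 2%N 3%N) -mul_bin_diag bin1 (mulnCA 3%N) ltn_pmul2l ?(leq_trans _ Q4) //.
  by case: Q Q4 {P hornerP PT} => // Q Q3; rewrite mulnS mulSn ltn_add2r.
have [s [s0 s1 Ts]] : exists s : R, [/\ 0 < s, s < 1 & T.[s] < 0].
  apply: (@filter_ex _ (1^'-)%classic).
  near=> s; split; near: s.
  - exact: nbhs_left_gt.
  - exact: nbhs_left_lt.
  - apply: (cvgr_lt T.[1]) => //; apply: cvg_at_left_filter; exact: continuous_horner.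
have rho01 : 0 < s ^+ 3 < 1 by rewrite exprn_gt0 // exprn_ilt1 // ltW.
apply: le_lt_trans (theta_le _ rho01) _.
have sQ : (s ^+ 3) `^ (Q%:R / 3) = s ^+ Q.
  rewrite -[s ^+ 3](powR_mulrn 3 (ltW s0)) -powRrM mulrC divfK ?pnatr_eq0 //.
  by rewrite powR_mulrn // ltW.
rewrite /theta_fun powRN sQ ltr_pdivrMr ?exprn_gt0 // -subr_gt0.
suff -> : Q%:R * s ^+ Q - \sum_(0 <= i < Q) (s ^+ 3) ^+ i = T.[s] * (s - 1).
  by rewrite nmulr_rgt0 // subr_lt0.
have <- : P.[s] = T.[s] * (s - 1) by rewrite PT hornerM hornerXsubC.
rewrite hornerP big_mkord; congr (_ - _); apply: eq_bigr => i _.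
by rewrite exprM.
Unshelve. all: by end_near.
Qed.

(** As [r >= 3], the degree bound [(q - 1) n / r] is at most
    [(q - 1) n / 3], the exponent built into [theta]. *)
Lemma sum_Mcount_le (R : realType) (p q n : nat) :
  (0 < n)%N ->
  (\sum_(3 <= r < p.+1) r * stirling2 p r * Mcount q.-1 n ((q.-1 * n) %/ r))%N%:R
    <= (Bsum p)%:R * theta R q ^+ n.
Proof.
move=> n0; rewrite /Bsum !natr_sum mulr_suml.
rewrite big_nat_cond [leRHS]big_nat_cond; apply: ler_sum => r /andP[/andP[r3 _] _].
rewrite natrM ler_wpM2l // Mcount_le_theta //.
by rewrite (leq_trans _ (leq_divM _ r)) // mulnC leq_mul2l r3 orbT.
Qed.

Theorem theorem5p3 (R : realType) (p k q n : nat) (F : finFieldType)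
    (p_prime : prime p) (p_odd : odd p) (q_def : q = (p ^ k)%N)
    (q_gt4 : (4 < q)%N) (cardF : #|F| = q) (n_gt0 : (0 < n)%N) :
  [/\ forall A : {set 'rV[F]_n}, A \subset torus F n ->
        (no_distinct_zero_sum p A <->
           distinctly_free (nonzeros F) (mpoly.mesym p F 1) A) /\
        (no_distinct_zero_sum p A ->
           (#|A| <= \sum_(3 <= r < p.+1)
                      r * stirling2 p r * Mcount q.-1 n ((q.-1 * n) %/ r))%N /\
           (\sum_(3 <= r < p.+1)
              r * stirling2 p r * Mcount q.-1 n ((q.-1 * n) %/ r))%N%:R
             <= (Bsum p)%:R * theta R q ^+ n),
      forall s : seq 'rV[F]_n, {subset s <= torus F n} ->
        no_zero_sum_subseq p s ->
        (size s)%:R <= p.-1%:R * (Bsum p)%:R * theta R q ^+ n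
    & theta R q < q.-1%:R].
Proof.
have chFp : p \in [pchar F] by apply: (@card_finPcharP _ _ k); rewrite ?cardF.
have cardA (A : {set 'rV[F]_n}) : A \subset torus F n -> no_distinct_zero_sum p A ->
    (#|A| <= \sum_(3 <= r < p.+1)
       r * stirling2 p r * Mcount q.-1 n ((q.-1 * n) %/ r))%N.
  by rewrite -cardF; exact: card_no_distinct_zero_sum.
split; last exact: theta_lt.
- move=> A AT; split; first exact: no_distinct_zero_sumP.
  by move=> noA; split; [exact: cardA | exact: sum_Mcount_le].
- move=> s sT nos.
  have supT : [set x in s] \subset torus F n.
    by apply/subsetP => x; rewrite inE; exact: sT.
  have := cardA _ supT (no_zero_sum_subseq_support nos).
  rewrite -(ler_nat R) => /le_trans/(_ (sum_Mcount_le R p q n_gt0)) supB.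
  have := size_le_card_mem (no_zero_sum_subseq_count chFp nos).
  rewrite -(ler_nat R) natrM => /le_trans; apply.
  by rewrite -mulrA ler_wpM2l.
Qed.
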